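(* Let $L$ be a modular algebraic lattice and let $K(L)$ be the join-semilattice of its compact elements. Then: (a) $L$ is well-founded if and only if $K(L)$ is well-founded and contains no join-subsemilattice isomorphic to $[\omega]^{<\omega}$; (b) $L$ is scattered if and only if $K(L)$ is scattered and contains no join-subsemilattice isomorphic to $[\omega]^{<\omega}$.
   Context: A lattice is algebraic if it is complete and every element is a supremum of compact elements. A poset is well-founded if every non-empty subset has a minimal element; it is scattered if it contains no subset isomorphic to the chain of rational numbers. A join-subsemilattice is a subset closed under binary joins, with the induced order. $[\omega]^{<\omega}$ is the set of finite subsets of $\omega$ ordered by inclusion. *)

(* Defs.v *)
From HB Require Import structures.
From mathcomp Require Import all_boot all_order all_algebra finmap.
From mathcomp Require Import boolp classical_sets functions cardinality.

Import Order.Theory.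

Local Open Scope classical_set_scope.

(* Isomorphism of (A, rA) and (B, rB), where a subset of an ordered type
   carries the restriction of the ambient order. *)
Definition order_isomorphic {T U : Type}
    (rA : rel T) (A : set T) (rB : rel U) (B : set U) : Prop :=
  exists2 f : T -> U, set_bij A B f &
    forall x y, A x -> A y -> rB (f x) (f y) = rA x y.

Section Posets.
Context {d : Order.disp_t} {T : porderType d}.
Implicit Types (P S : set T) (m x : T).

Definition minimal_in S m : Prop :=
  S m /\ forall x, S x -> (x <= m)%O -> x = m.

Definition well_founded_poset P : Prop :=
  forall S, S `<=` P -> S !=set0 -> exists m, minimal_in S m.

Definition scattered_poset P : Prop :=
  ~ exists2 S, S `<=` P &
      order_isomorphic (<=%O : rel rat) [set: rat] (<=%O : rel T) S.

End Posets.

Section JoinSubsemilattices.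
Context {d : Order.disp_t} {T : joinSemilatticeType d}.
Implicit Types (P S : set T).

Definition join_closed S : Prop :=
  forall x y, S x -> S y -> S (Order.join x y).

(* P is meant to be join-closed itself, so that the joins of P are those
   of T; see compact_elements_join for the set of compact elements. *)
Definition join_subsemilattice P S : Prop := S `<=` P /\ join_closed S.

Definition contains_finite_subsets_of_omega P : Prop :=
  exists2 S, join_subsemilattice P S &
    order_isomorphic (@fsubset nat) [set: {fset nat}] (<=%O : rel T) S.

End JoinSubsemilattices.

Section AlgebraicLattices.
Context {d : Order.disp_t}.

(* The empty set is included, so a complete lattice has both bounds. *)
Definition complete_lattice (L : latticeType d) : Prop :=
  forall A : set L, supremums A !=set0 /\ infimums A !=set0.

Definition modular_lattice (L : latticeType d) : Prop :=
  forall x y z : L, (x <= z)%O ->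
    Order.join x (Order.meet y z) = Order.meet (Order.join x y) z.

(* B may be empty: the least element of a complete lattice is compact. *)
Definition compact_element {L : latticeType d} (x : L) : Prop :=
  forall (A : set L) (s : L), supremums A s -> (x <= s)%O ->
    exists B : set L, [/\ B `<=` A, finite_set B &
      exists2 t, supremums B t & (x <= t)%O].

Definition compact_elements (L : latticeType d) : set L :=
  [set x | compact_element x].

Definition algebraic_lattice (L : latticeType d) : Prop :=
  complete_lattice L /\
  forall x : L, exists2 A : set L, A `<=` compact_elements L & supremums A x.

Lemma compact_elements_join (L : latticeType d) :
  complete_lattice L -> join_closed (compact_elements L).
Proof.
move=> cL x y Kx Ky A s sA; rewrite leUx => /andP[xs ys].
have [B [BA Bfin [b [ubB lubB] xb]]] := Kx A s sA xs.
have [C [CA Cfin [c [ubC lubC] yc]]] := Ky A s sA ys.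
exists (B `|` C); split.
- by move=> z [/BA|/CA].
- by rewrite finite_setU.
have [[t supt] _] := cL (B `|` C); exists t => //.
have [ubt _] := supt.
rewrite leUx; apply/andP; split.
  by apply: le_trans xb _; apply: lubB => z Bz; apply: ubt; left.
by apply: le_trans yc _; apply: lubC => z Cz; apply: ubt; right.
Qed.

End AlgebraicLattices.

(* Main.v *)
Require Import Defs.
From HB Require Import structures.
From mathcomp Require Import all_boot all_order all_algebra finmap.
From mathcomp Require Import boolp classical_sets functions cardinality.

(* If K(L) contains [omega]^{<omega}, mapping a set of naturals to the join of
   the corresponding atoms embeds the power set of omega in L, and the power
   set contains chains of types omega^* and eta.

   Conversely, let C be a chain of type omega^* (resp. eta) in L. If every
   compact s below some element of C makes x |-> s /\ x identify two elements
   of C arbitrarily far down (resp. in every interval), then modularity lets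
   one pick greedily an infinite independent family of compact elements, which
   generates a copy of [omega]^{<omega}. Otherwise s /\ C again contains a
   chain of the same type, now below a compact s which is itself below an
   element of C. For omega^*, this shows that the set of compact elements
   bounding such a chain has no minimal element. For eta, it shows (working
   above a compact element) that whenever an interval [b, c] of L with b
   compact is not scattered, there is a compact z such that [b, z] and [z, c]
   are both not scattered; iterating embeds the rationals in K(L). *)

Set Implicit Arguments.
Unset Strict Implicit.
Unset Printing Implicit Defensive.

Import Order.Theory GRing.Theory Num.Theory.

(** * Chains of rationals and infinite descending sequences in a poset *)

Section RationalChains.
Local Open Scope order_scope.
Context {d : Order.disp_t} {T : porderType d}.
Implicit Types (P : set T).

Lemma rat_dense (q r : rat) : q < r -> exists p, q < p < r.
Proof. by move=> /midf_lt[h1 h2]; exists ((q + r) / 2)%R; rewrite h1 h2. Qed.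

(** Strict monotonicity is enough: the rationals are totally ordered, so such a map also reflects
    the order. *)
Lemma nonscatteredP P :
  ~ scattered_poset P <->
  exists2 f : rat -> T, {homo f : x y / x < y} & forall x, P (f x).
Proof.
rewrite /scattered_poset; split=> [/contrapT[S SP [f [fS fi _] fm]]|[f fm fP]].
  exists f => [x y xy|x]; last exact/SP/fS.
  by rewrite lt_leAnge !fm// -ltNge (ltW xy).
apply; exists (range f); first by move=> _ [x _ <-].
have fmono : {mono f : x y / x <= y} by exact: le_mono.
exists f => [|x y _ _]; last exact: fmono.
split=> [x _|x y _ _|]; [by exists x|exact: (inc_inj fmono)|by []].
Qed.

Lemma scattered_subset P (Q : set T) :
  (P `<=` Q)%classic -> scattered_poset Q -> scattered_poset P.
Proof. by move=> PQ sQ [S SP iS]; apply: sQ; exists S => // x /SP/PQ. Qed.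

Lemma well_founded_subset P (Q : set T) :
  (P `<=` Q)%classic -> well_founded_poset Q -> well_founded_poset P.
Proof. by move=> PQ wfQ S SP; apply: wfQ => x /SP/PQ. Qed.

Lemma descending_of_not_well_founded P : ~ well_founded_poset P ->
  exists2 x : nat -> T, (forall n, P (x n)) & (forall n, x n.+1 < x n).
Proof.
move=> /existsNP[S] /not_implyP[SP] /not_implyP[[s0 Ss0]] nomin.
have step (s : {s | S s}) : {s' : {s | S s} | sval s' < sval s}.
  apply: cid; case: s => s Ss /=; apply: contrapT => H; apply: nomin.
  exists s; split=> // x Sx xs; apply: contrapT => /eqP xns; apply: H.
  by exists (exist _ x Sx); rewrite lt_neqAle xns.
have [f [_ fS]] := dependent_choice step (exist _ s0 Ss0).
by exists (sval \o f) => //= n; apply: SP; exact: svalP.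
Qed.

Lemma not_well_founded_of_descending P (x : nat -> T) :
  (forall n, P (x n)) -> (forall n, x n.+1 < x n) -> ~ well_founded_poset P.
Proof.
move=> xP xd /(_ (range x))[_ [n _ <-]||_ [[n _ <-] nmin]] //.
  by exists (x 0%N); exists 0%N.
have E : x n.+1 = x n by apply: nmin; [exists n.+1|exact: ltW].
by have := xd n; rewrite E ltxx.
Qed.

End RationalChains.

(* The forth half of Cantor's back-and-forth argument. *)
Section Forth.
Local Open Scope order_scope.
Context {d : Order.disp_t} {T : porderType d}.
Variables (P : set T) (R : T -> T -> Prop).
Hypothesis R_lt : forall x y, R x y -> x < y.
Hypothesis R_widen : forall x y x' y', x' <= x -> y <= y' -> R x y -> R x' y'.
Hypothesis R_split : forall x y, P x -> R x y ->
  exists z, [/\ P z, R x z & R z y].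

(** The graph of a finite partial map carrying [<] to [R]. Plain [<] would not do, as only [R] can
    be split further. *)
Let compatible (s : seq (rat * T)) := forall p p', p \in s -> p' \in s ->
  (p.1 < p'.1 -> R p.2 p'.2) /\ (p.1 = p'.1 -> p.2 = p'.2).

Let compatible_cons p s : compatible (p :: s) -> compatible s.
Proof.
by move=> cs p1 p2 p1s p2s; apply: cs; rewrite inE ?p1s ?p2s orbT.
Qed.

Let compatible_le s p p' : compatible s -> p \in s -> p' \in s ->
  p.2 <= p'.2 \/ p'.2 <= p.2.
Proof.
move=> cs ps p's; case: (ltgtP p.1 p'.1) => [h|h|h].
- by left; apply/ltW/R_lt/(cs p p' ps p's).1.
- by right; apply/ltW/R_lt/(cs p' p p's ps).1.
- by left; rewrite ((cs p p' ps p's).2 h).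
Qed.

(** Induction on [s] raises [b] past the values left of [q] and lowers [c] past those right of it,
    keeping [R b c]. The values are pairwise comparable; for the ends, which need not be values of
    [s], comparability is assumed. *)
Let gap (q : rat) (s : seq (rat * T)) (b c : T) :
    P b -> R b c -> compatible s ->
    (forall p, p \in s -> [/\ P p.2, p.1 != q,
      p.1 < q -> R p.2 c /\ (p.2 <= b \/ b <= p.2) &
      q < p.1 -> R b p.2 /\ (c <= p.2 \/ p.2 <= c)]) ->
  exists l h, [/\ P l, R l h, b <= l, h <= c &
    forall p, p \in s -> (p.1 < q -> p.2 <= l) /\ (q < p.1 -> h <= p.2)].
Proof.
elim: s b c => [|p s IH] b c Pb Rbc cs sP; first by exists b, c; split.
have cs' := compatible_cons cs.
have ps : p \in p :: s by rewrite mem_head.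
have ss p' : p' \in s -> p' \in p :: s by rewrite inE => ->; rewrite orbT.
have [Pp pq pl ph] := sP p ps.
case: (ltgtP p.1 q) pq => // [ltpq|ltqp] _.
  have [Rpc pb] := pl ltpq.
  have [b' [Pb' Rbc' bb' pb' sP']] : exists b', [/\ P b', R b' c, b <= b',
      p.2 <= b' & forall p', p' \in s -> [/\ P p'.2, p'.1 != q,
      p'.1 < q -> R p'.2 c /\ (p'.2 <= b' \/ b' <= p'.2) &
      q < p'.1 -> R b' p'.2 /\ (c <= p'.2 \/ p'.2 <= c)]].
    case: pb => [pb|bp].
      by exists b; split=> // p' /ss/sP.
    exists p.2; split=> // p' /ss p's.
    have [Pp' p'q p'l p'h] := sP _ p's; split=> // h.
      by split; [have [] := p'l h|exact: compatible_le cs _ _].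
    split; last by have [] := p'h h.
    by apply: (cs p p' ps p's).1; apply: lt_trans h.
  have [l [h [Pl Rlh bl hc lh]]] := IH b' c Pb' Rbc' cs' sP'.
  exists l, h; split=> //; first exact: le_trans bl.
  move=> p'; rewrite inE => /orP[/eqP->|/lh//]; split=> [_|].
    exact: le_trans bl.
  by rewrite ltNge (ltW ltpq).
have [Rbp pc] := ph ltqp.
have [c' [Rbc' cc' cp sP']] : exists c', [/\ R b c', c' <= c,
    c' <= p.2 & forall p', p' \in s -> [/\ P p'.2, p'.1 != q,
    p'.1 < q -> R p'.2 c' /\ (p'.2 <= b \/ b <= p'.2) &
    q < p'.1 -> R b p'.2 /\ (c' <= p'.2 \/ p'.2 <= c')]].
  case: pc => [cp|pc].
    by exists c; split=> // p' /ss/sP.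
  exists p.2; split=> // p' /ss p's.
  have [Pp' p'q p'l p'h] := sP _ p's; split=> // h.
    split; last by have [] := p'l h.
    by apply: (cs p' p p's ps).1; apply: lt_trans ltqp.
  by split; [have [] := p'h h|exact: compatible_le cs _ _].
have [l [h [Pl Rlh bl hc lh]]] := IH b c' Pb Rbc' cs' sP'.
exists l, h; split=> //; first exact: le_trans cc'.
move=> p'; rewrite inE => /orP[/eqP->|/lh//]; split=> [|_].
  by rewrite ltNge (ltW ltqp).
exact: le_trans cp.
Qed.

Lemma rat_chain_of_split b c : P b -> R b c ->
  exists2 f : rat -> T, {homo f : x y / x < y} & forall x, P (f x).
Proof.
move=> Pb Rbc.
pose good s := compatible s /\
  forall p, p \in s -> [/\ P p.2, R b p.2 & R p.2 c].
(* Stage [n] adds the rational with code [n], if there is one and it has no value yet. *)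
have ext (n : nat) (s : {s | good s}) : {s' : {s | good s} |
    {subset sval s <= sval s'} &
    forall q : rat, choice.pickle q = n -> exists2 p, p \in sval s' & p.1 = q}.
  apply: cid2; case: s => s [cs gs] /=.
  have [[q qn]|noq] := pselect (exists q : rat, choice.pickle q = n); last first.
    by exists (exist _ s (conj cs gs)) => // q qn; case: noq; exists q.
  have qU q' : choice.pickle q' = n -> q' = q.
    by rewrite -qn => /(pcan_inj choice.pickleK).
  have [[p ps pq]|nop] := pselect (exists2 p, p \in s & p.1 = q).
    exists (exist _ s (conj cs gs)) => // q' /qU->.
    by exists p.
  have sq p : p \in s -> p.1 != q.
    by move=> ps; apply/eqP => pq; apply: nop; exists p.
  have [|l [h [Pl Rlh bl hc lh]]] := gap (q := q) Pb Rbc cs.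
    move=> p ps; have [Pp Rbp Rpc] := gs p ps; split=> //.
    - exact: sq.
    - by move=> _; split=> //; right; exact/ltW/R_lt.
    - by move=> _; split=> //; right; exact/ltW/R_lt.
  have [z [Pz Rlz Rzh]] := R_split Pl Rlh.
  have ge : good ((q, z) :: s).
    split=> [p p'|p]; rewrite !inE.
      move=> /orP[/eqP->|ps] /orP[/eqP->|p's] /=.
      - by split=> //; rewrite ltxx.
      - split=> [qp'|/esym/eqP]; last by rewrite (negPf (sq _ p's)).
        by apply: R_widen Rzh => //; exact: (lh p' p's).2.
      - split=> [qp'|/eqP]; last by rewrite (negPf (sq _ ps)).
        by apply: R_widen Rlz => //; exact: (lh p ps).1.
      - exact: cs.
    move=> /orP[/eqP->|/gs//]; split=> //=.
    + exact: R_widen Rlz.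
    + exact: R_widen Rzh.
  exists (exist _ _ ge) => [p /= ps|q' /qU->]; first by rewrite inE ps orbT.
  by exists (q, z) => //=; rewrite mem_head.
have good0 : good [::] by [].
pose st := fix st n : {s | good s} :=
  if n is m.+1 then s2val (ext m (st m)) else exist _ _ good0.
have st_mono m n : (m <= n)%N -> {subset sval (st m) <= sval (st n)}.
  elim: n => [|n IH]; first by rewrite leqn0 => /eqP->.
  rewrite leq_eqVlt => /orP[/eqP->//|/IH h p /h].
  exact: (s2valP (ext n (st n))).
have val_ex (q : rat) : exists v, (q, v) \in sval (st (choice.pickle q).+1).
  pose k := choice.pickle q.
  have [p pk pq] := s2valP' (ext k (st k)) q erefl.
  by exists p.2; rewrite -pq -surjective_pairing pq.
have [f fP] := boolp.choice val_ex.
exists f => [x y xy|x]; last first.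
  by have [_ /(_ _ (fP x))[]] := svalP (st (choice.pickle x).+1).
set m := maxn (choice.pickle x).+1 (choice.pickle y).+1.
have xm : (x, f x) \in sval (st m) by apply: st_mono (fP x); exact: leq_maxl.
have ym : (y, f y) \in sval (st m) by apply: st_mono (fP y); exact: leq_maxr.
by have [/(_ _ _ xm ym)[/(_ xy)/R_lt]] := svalP (st m).
Qed.

End Forth.

(** * Compact elements of an algebraic lattice *)

Section CompactElements.
Local Open Scope order_scope.
Context {d : Order.disp_t} {L : latticeType d}.
Hypothesis algL : algebraic_lattice L.
Local Notation K := (compact_elements L).
Local Notation "x /\o y" := (Order.meet x y) (at level 48, left associativity).
Local Notation "x \/o y" := (Order.join x y) (at level 50, left associativity).
Implicit Types (b c t u v : L).

Let complL : complete_lattice L := algL.1.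
Let K_join (a b : L) : K a -> K b -> K (a \/o b) := compact_elements_join L complL a b.

Lemma supremum_exists (A : set L) :
  exists x, forall z, x <= z <-> forall y, A y -> y <= z.
Proof.
have [[x [ubx lbx]] _] := complL A; exists x => z; split=> [xz y Ay|].
  exact: le_trans (ubx y Ay) xz.
exact: lbx.
Qed.

Lemma least_compact : exists2 b, K b & forall x, b <= x.
Proof.
have [b bP] := supremum_exists set0; have b0 x : b <= x by apply/bP.
exists b => // A s _ _; exists set0; split=> //.
have [[t supt] _] := complL set0; by exists t.
Qed.

(** Otherwise [v] would bound the compact elements whose supremum is [u]. *)
Lemma compact_separation u v : ~~ (u <= v) ->
  exists k, [/\ K k, k <= u & ~~ (k <= v)].
Proof.
move=> uv; apply: contrapT => H; have [A AK [ubA lbA]] := algL.2 u.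
case/negP: uv; apply: lbA => k Ak; apply: contrapT => /negP kv; apply: H.
by exists k; split=> //; [exact: AK|exact: ubA].
Qed.

(** [g X] is the supremum of the images [a n] of singletons, for [n] in [X]. Compactness of [a n]
    reduces [a n <= g Y] to a finite subset of [Y], where [f] decides membership. *)
Lemma powerset_embedding : contains_finite_subsets_of_omega K ->
  exists g : set nat -> L, forall X Y, g X <= g Y <-> (X `<=` Y)%classic.
Proof.
move=> [S [SK _] [f [fS _ _] fm]].
have {}fm F G : (f F <= f G) = fsubset F G by exact: fm.
have Kf F : K (f F) by apply/SK/fS.
pose a n := f [fset n]%fset.
have aP n F : (a n <= f F) = (n \in F) by rewrite fm fsub1set.
have [g gP] :=
  boolp.choice (fun X : set nat => supremum_exists (a @` X)%classic).
have {}gP X z : g X <= z <-> forall n, X n -> a n <= z.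
  split=> [/(gP X z).1 h n Xn|h]; first by apply: h; exists n.
  by apply/(gP X z).2 => _ [n Xn <-]; exact: h.
have ag n X : X n -> a n <= g X by move: n; exact/gP.
exists g => X Y; split=> [gXY n Xn|XY]; last first.
  by apply/gP => n /XY/ag.
have := le_trans (ag n X Xn) gXY.
have supY : supremums (a @` Y)%classic (g Y).
  split=> [_ [i Yi <-]|z zub]; first exact: ag.
  by apply/gP => i Yi; apply: zub; exists i.
move=> /(Kf _ _ _ supY)[B [BY Bfin [t [_ lbt] nt]]].
have [F FY BF] : exists2 F : {fset nat}, (forall i, i \in F -> Y i) &
    forall z, B z -> z <= f F.
  have [s Bs] := (finite_seqP B).1 Bfin.
  have sY z : z \in s -> exists2 n, Y n & a n = z.
    by move=> zs; apply: BY; rewrite Bs.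
  suff [F FY sF] : exists2 F : {fset nat}, (forall i, i \in F -> Y i) &
      forall z, z \in s -> z <= f F.
    by exists F => // z; rewrite Bs => /sF.
  elim: s sY {Bs} => [|z s IH] sY; first by exists fset0 => i; rewrite inE.
  have [m Ym <-] := sY z (mem_head z s).
  have [z' z's|F FY sF] := IH; first by apply: sY; rewrite inE z's orbT.
  exists (m |` F)%fset => [i|z']; rewrite inE.
    by move=> /orP[|/FY//]; rewrite inE => /eqP->.
  move=> /orP[/eqP->|/sF z'F]; first by rewrite aP fset1U1.
  by apply: le_trans z'F _; rewrite fm fsubsetUr.
by apply: FY; rewrite -aP; apply: le_trans nt _; apply: lbt.
Qed.

(** The final segments of omega form a strictly descending sequence. *)
Lemma well_founded_omits : well_founded_poset [set: L] ->
  ~ contains_finite_subsets_of_omega K.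
Proof.
move=> wfL /powerset_embedding[g gP].
apply: (not_well_founded_of_descending (P := setT)
          (x := fun n => g (fun i => n <= i)%N)) wfL => // n.
rewrite lt_leAnge; apply/andP; split; first by apply/gP => i /=; exact: ltnW.
by apply/negP => /gP /(_ n (leqnn n)) /=; rewrite ltnn.
Qed.

(* The rationals are realised by their Dedekind cuts, coded as sets of
   naturals. *)
Lemma scattered_omits : scattered_poset [set: L] ->
  ~ contains_finite_subsets_of_omega K.
Proof.
move=> + /powerset_embedding[g gP]; apply/nonscatteredP.
pose cut (q : rat) : set nat := fun n =>
  exists2 r : rat, choice.pickle r = n & r < q.
exists (g \o cut) => //= x y xy.
rewrite lt_leAnge; apply/andP; split.
  by apply/gP => _ [r <- rx]; exists r => //; exact: lt_trans xy.
apply/negP => /gP /(_ (choice.pickle x))[|r]; first by exists x.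
by move/(pcan_inj choice.pickleK) ->; rewrite ltxx.
Qed.

(** * Independent families of compact elements *)

Let span b (a : nat -> L) (s : seq nat) := foldr (fun i z => a i \/o z) b s.

Let span_leP b a s z :
  span b a s <= z <-> b <= z /\ forall i, i \in s -> a i <= z.
Proof.
elim: s => [|i s IH] /=; first by split=> [|[]].
rewrite leUx; split=> [/andP[aiz /IH[bz sz]]|[bz sz]].
  by split=> // j; rewrite inE => /orP[/eqP->|/sz].
rewrite sz ?mem_head//=; apply/IH; split=> // j js.
by apply: sz; rewrite inE js orbT.
Qed.

(** Sending a finite set to the join of [b] with its generators turns unions into joins;
    independence makes this map reflect inclusion. *)
Lemma contains_of_independent b (a : nat -> L) : K b -> (forall n, K (a n)) ->
  (forall n s, n \notin s -> ~~ (a n <= span b a s)) ->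
  contains_finite_subsets_of_omega K.
Proof.
move=> Kb Ka indep; pose f (F : {fset nat}) := span b a (enum_fset F).
have fP F z : f F <= z <-> b <= z /\ forall i, i \in F -> a i <= z.
  exact: span_leP.
have fF F := (fP F (f F)).1 (lexx _).
have Kf F : K (f F).
  by rewrite /f /span; elim: (enum_fset F) => //= i s; exact: K_join.
have fm F G : (f F <= f G) = fsubset F G.
  apply/idP/fsubsetP => [FG i iF|FG].
    apply: contraT => iG; case/negP: (indep i _ iG).
    exact: le_trans ((fF F).2 i iF) FG.
  by apply/fP; split=> [|i /FG]; [exact: (fF G).1|exact: (fF G).2].
exists (range f); first split.
- by move=> _ [F _ <-].
- move=> _ _ [F _ <-] [G _ <-]; exists (F `|` G)%fset => //.
  apply/le_anti/andP; split.
    apply/fP; split=> [|i]; first by apply: lexU2; rewrite (fF F).1.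
    rewrite inE => /orP[/(fF F).2|/(fF G).2] h; apply: lexU2; rewrite h //.
    by rewrite orbT.
  by rewrite leUx !fm fsubsetUl fsubsetUr.
exists f => [|F G _ _]; last exact: fm.
split=> [F _|F G _ _ FG|]; [by exists F| |by []].
by apply/eqP; rewrite eqEfsubset -!fm FG lexx.
Qed.

(* Greedy construction: the next pair (v', u') is chosen so that the join s of
   the elements picked so far no longer distinguishes u' from v'; by
   modularity, a compact element below u' but not below v' is then not below
   s \/ v', while all later choices are below v'. *)
Lemma contains_of_locally_constant b t (D : L -> L -> Prop) :
    modular_lattice L -> K b -> b <= t ->
    (forall v u, D v u -> [/\ b <= v, v < u & u <= t]) ->
    (exists v u, D v u) ->
    (forall s v u, K s -> b <= s -> s <= t -> D v u ->
      exists v' u', [/\ D v' u', u' <= v & s /\o u' = s /\o v']) ->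
  contains_finite_subsets_of_omega K.
Proof.
move=> modL Kb bt DP [v0 [u0 D0]] Dconst.
pose inv (S : L * L * L) := let: (s, v, u) := S in
  [/\ K s, b <= s, s <= t, D v u & s /\o u = s /\o v].
pose next (S S' : L * L * L) (a : L) :=
  let: (s, v, u) := S in let: (s', v', u') := S' in
  [/\ K a, a <= u, ~~ (a <= v), s' = s \/o a & u' <= v].
have step (S : {S | inv S}) :
    {S' : {S | inv S} | exists a, next (sval S) (sval S') a}.
  apply: cid; case: S => [[[s v] u] /= iS]; have [Ks bs st Dvu _] := iS.
  have [bv vu ut] := DP _ _ Dvu.
  have [|a [Ka au av]] := @compact_separation u v; first by rewrite lt_geF.
  have [|||v' [u' [D' u'v E]]] := Dconst (s \/o a) v u _ _ _ Dvu.
  - exact: K_join.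
  - by apply: lexU2; rewrite bs.
  - by rewrite leUx st (le_trans au ut).
  have iS' : inv (s \/o a, v', u').
    split=> //; [exact: K_join|by apply: lexU2; rewrite bs|].
    by rewrite leUx st (le_trans au).
  by exists (exist _ _ iS'); exists a.
have i0 : inv (b, v0, u0).
  have [bv vu ut] := DP _ _ D0; split=> //.
  by rewrite !meet_l // (le_trans bv (ltW vu)).
have [S [_ Snext]] := dependent_choice step (exist _ _ i0).
have [a aP] := boolp.choice Snext.
pose s n := (sval (S n)).1.1; pose v n := (sval (S n)).1.2.
pose u n := (sval (S n)).2.
have Sinv n : [/\ K (s n), b <= s n, s n <= t, D (v n) (u n) &
    s n /\o u n = s n /\o v n].
  by rewrite /s /v /u; have := svalP (S n); case: (sval (S n)) => [[]].
have {}aP n : [/\ K (a n), a n <= u n, ~~ (a n <= v n),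
    s n.+1 = s n \/o a n & u n.+1 <= v n].
  rewrite /s /v /u; have := aP n.
  by case: (sval (S n)) (sval (S n.+1)) => [[? ?] ?] [[]].
have vu n : v n <= u n by have [_ _ _ /DP[_ /ltW]] := Sinv n.
have s_mono m n : (m <= n)%N -> s m <= s n.
  elim: n => [|n IH]; first by rewrite leqn0 => /eqP->.
  rewrite leq_eqVlt => /orP[/eqP->//|/IH h].
  by have [_ _ _ -> _] := aP n; apply: lexU2; rewrite h.
have uv m n : (n < m)%N -> u m <= v n.
  elim: m => // m IH; have [_ _ _ _ umv] := aP m.
  rewrite ltnS leq_eqVlt => /orP[/eqP->//|/IH h].
  by apply: le_trans umv _; apply: le_trans (vu m) h.
apply: (contains_of_independent (b := b) (a := a) Kb) => [n|n l nl].
  by have [] := aP n.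
have [Kan anu anv _ _] := aP n; have [_ bs _ _ E] := Sinv n.
apply: contra anv => al.
(* Picks before [n] are below [s n], later ones below [v n], and [n] itself is not in [l]. *)
have : a n <= v n \/o s n.
  apply: le_trans al _; apply/span_leP; split=> [|i il].
    by apply: lexU2; rewrite bs orbT.
  apply: lexU2; case: (ltngtP i n) => [lt|gt|eq].
  - have [_ _ _ si _] := aP i.
    by apply/orP; right; apply: le_trans (s_mono _ _ lt); rewrite si leUr.
  - have [_ ai _ _ _] := aP i.
    by apply/orP; left; apply: le_trans ai (uv _ _ gt).
  - by rewrite -eq il in nl.
(* By modularity this meet is [v n \/o (s n /\o u n)], that is [v n \/o (s n /\o v n)], which is
   [v n]. *)
move=> avs; have : a n <= (v n \/o s n) /\o u n by rewrite lexI avs.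
by rewrite -modL// E => /le_trans; apply; rewrite leUx lexx leIr.
Qed.

(** * Transfer from the compact elements to the whole lattice *)

(** Either some compact [s] below [x 1] meets a tail of [x] in a strictly descending sequence, or
    every such [s] fails to separate consecutive terms arbitrarily far down. The bound [x 1] is
    strictly below [x 0], so repeating the lemma on [y] gives a strictly smaller compact bound. *)
Lemma compact_above_descending (x : nat -> L) : modular_lattice L ->
    ~ contains_finite_subsets_of_omega K -> (forall n, x n.+1 < x n) ->
  exists c, [/\ K c, c <= x 1%N &
    exists2 y : nat -> L, (forall n, y n <= c) & forall n, y n.+1 < y n].
Proof.
move=> modL omitsL xd; apply: contrapT => noc; apply: omitsL.
have [b Kb b0] := least_compact.
have x_anti m n : (m <= n)%N -> x n <= x m.
  elim: n => [|n IH]; first by rewrite leqn0 => /eqP->.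
  rewrite leq_eqVlt => /orP[/eqP->//|/IH h].
  exact: le_trans (ltW (xd n)) h.
pose D v u := exists2 n, (0 < n)%N & v = x n.+1 /\ u = x n.
apply: (contains_of_locally_constant (D := D) modL Kb (b0 (x 1%N))).
- by move=> v u [n n0 [-> ->]]; split=> //; exact: x_anti.
- by exists (x 2%N), (x 1%N); exists 1%N.
move=> s v u Ks _ st [n n0 [-> _]]; apply: contrapT => H; apply: noc.
exists s; split=> //; exists (fun k => s /\o x (n.+1 + k)%N) => k.
  exact: leIl.
rewrite addnS lt_neqAle leI2 ?(ltW (xd _))// andbT.
apply/eqP => E; apply: H.
exists (x (n.+1 + k).+1), (x (n.+1 + k)%N); split=> //.
  by exists (n.+1 + k)%N.
by apply: x_anti; rewrite leq_addr.
Qed.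

Lemma well_founded_of_compact : modular_lattice L -> well_founded_poset K ->
  ~ contains_finite_subsets_of_omega K -> well_founded_poset [set: L].
Proof.
move=> modL wfK omitsL; apply: contrapT.
move=> /descending_of_not_well_founded[x _ xd].
pose S c := K c /\
  exists2 y : nat -> L, (forall n, y n <= c) & forall n, y n.+1 < y n.
have step y : (forall n, y n.+1 < y n) -> exists2 c, S c & c <= y 1%N.
  by move=> /(compact_above_descending modL omitsL)[c [Kc cy yc]]; exists c.
have [c Sc _] := step x xd.
have [|c0 [[Kc0 [y yc0 yd]] c0min]] := wfK S _ (ex_intro _ c Sc).
  by move=> ? [].
have [c' Sc' c'y] := step y yd.
have lt : c' < c0 by apply: le_lt_trans c'y (lt_le_trans (yd 0%N) (yc0 _)).
by have := lt; rewrite (c0min c' Sc' (ltW lt)) ltxx.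
Qed.

(* A bounded interval of rationals replaces the whole chain, so that cutting it
   into pieces requires no reparametrisation. *)
Definition rat_chain b c := exists (x : rat -> L) (q r : rat), [/\ q < r,
  forall y z, q < y -> y < z -> z < r -> x y < x z &
  forall y, q < y -> y < r -> b <= x y /\ x y <= c].

Lemma rat_chain_lt b c : rat_chain b c -> b < c.
Proof.
move=> [x [q [r [qr xi xbc]]]].
have [p /andP[qp pr]] := rat_dense qr.
have [p' /andP[pp' p'r]] := rat_dense pr.
apply: le_lt_trans (xbc p qp pr).1 _.
exact: lt_le_trans (xi p p' qp pp' p'r) (xbc p' (lt_trans qp pp') p'r).2.
Qed.

Lemma rat_chain_widen b c b' c' : b' <= b -> c <= c' ->
  rat_chain b c -> rat_chain b' c'.
Proof.
move=> b'b cc' [x [q [r [qr xi xbc]]]]; exists x, q, r; split=> // y qy yr.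
have [by_ yc] := xbc y qy yr.
by rewrite (le_trans b'b by_) (le_trans yc cc').
Qed.

Lemma rat_chain_split b c : modular_lattice L ->
    ~ contains_finite_subsets_of_omega K -> K b -> rat_chain b c ->
  exists z, [/\ K z, rat_chain b z & rat_chain z c].
Proof.
move=> modL omitsL Kb [x [q [r [qr xi xbc]]]].
have [p /andP[qp pr]] := rat_dense qr.
(* The piece of the chain on [(p, r)] lies above [x p], hence in [[z, c]]; only the lower half
   remains to be found. *)
suff [z [Kz zp bz]] : exists z, [/\ K z, z <= x p & rat_chain b z].
  exists z; split=> //; exists x, p, r; split=> // [y y' py|y py yr].
    by apply: xi; exact: lt_trans py.
  split; last exact: (xbc y (lt_trans qp py) yr).2.
  by apply: le_trans zp _; exact/ltW/xi.
apply: contrapT => noz; apply: omitsL.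
pose D v u := exists (y z : rat), [/\ q < y, y < z, z < p, v = x y & u = x z].
apply: (contains_of_locally_constant (t := x p) (D := D) modL Kb).
- exact: (xbc p qp pr).1.
- move=> _ _ [y [z [qy yz zp -> ->]]].
  have zr := lt_trans zp pr; have qz := lt_trans qy yz; split.
  + exact: (xbc y qy (lt_trans yz zr)).1.
  + exact: xi.
  + exact/ltW/xi.
- have [y /andP[qy yp]] := rat_dense qp.
  have [z /andP[yz zp]] := rat_dense yp.
  by exists (x y), (x z), y, z.
move=> s v u Ks bs st [y [z [qy yz zp -> _]]].
(* If [s] separates all pairs below [y], the meets [s /\o x i] with [i] in [(q, y)] form a chain,
   and [s] serves as [z]. They lie above [b] because [b <= s], which is why the greedy construction
   starts at [b]. *)
apply: contrapT => H; apply: noz; exists s; split=> //.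
have yr := lt_trans yz (lt_trans zp pr).
exists (fun i => s /\o x i), q, y; split=> // [i j qi ij jy|i qi iy]; last first.
  by rewrite leIl lexI bs (xbc i qi (lt_trans iy yr)).1.
have xij : x i < x j by apply: xi => //; exact: lt_trans yr.
rewrite lt_neqAle leI2 ?(ltW xij)// andbT; apply/eqP => E; apply: H.
exists (x i), (x j); split=> //.
  by exists i, j; split=> //; exact: lt_trans (lt_trans yz zp).
by apply/ltW/xi => //; exact: lt_trans ij.
Qed.

Lemma scattered_of_compact : modular_lattice L -> scattered_poset K ->
  ~ contains_finite_subsets_of_omega K -> scattered_poset [set: L].
Proof.
move=> modL scK omitsL; apply: contrapT => /nonscatteredP[f fi _].
have [b Kb b0] := least_compact.
(* Restricting [f] to [(0, 1)] makes [f 1] an upper bound. *)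
have Rb1 : rat_chain b (f 1%R).
  exists f, 0%R, 1%R; split=> // [y z _ yz _|y _ y1]; first exact: fi.
  by split; [exact: b0|exact/ltW/fi].
move: scK; apply/nonscatteredP.
apply: (rat_chain_of_split rat_chain_lt _ _ Kb Rb1).
  by move=> x y x' y'; exact: rat_chain_widen.
by move=> x y; exact: rat_chain_split.
Qed.

End CompactElements.

Local Open Scope classical_set_scope.

Theorem mainTheorem8 (d : Order.disp_t) (L : latticeType d)
    (modL : modular_lattice L) (algL : algebraic_lattice L) :
  (well_founded_poset [set: L] <->
     well_founded_poset (compact_elements L) /\
     ~ contains_finite_subsets_of_omega (compact_elements L)) /\
  (scattered_poset [set: L] <->
     scattered_poset (compact_elements L) /\
     ~ contains_finite_subsets_of_omega (compact_elements L)).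
Proof.
split; split=> [h|[? ?]].
- by split; [exact: well_founded_subset h|exact: well_founded_omits].
- exact: well_founded_of_compact.
- by split; [exact: scattered_subset h|exact: scattered_omits].
- exact: scattered_of_compact.
Qed.
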